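(* If $H\in\{P_4,P_5,P_6,B_{3,3},B_{3,4},S_{2,2}\}$, then $\xi(H)=|V(H)|-1$.
   Context: $P_t$ is the path on $t$ vertices. The broom $B_{s,t}$ is the tree on $s+t$ vertices that is the union of a star with $s$ leaves and a path with $t$ vertices such that the star and the path share exactly one vertex, which is the center of the star and an end-point of the path. The double star $S_{k,\ell}$ is the tree on $k+\ell+2$ vertices obtained by taking two vertex-disjoint stars $K_{1,k}$ and $K_{1,\ell}$ and joining their centers with an edge. For a graph $H$, $\xi(H)$ is the largest integer $n$ such that there is an edge coloring of the complete graph $K_n$ with three colors in which every subgraph isomorphic to $H$ contains edges of all three colors (this holds vacuously if $K_n$ contains no copy of $H$). *)

(* Defs.v *)
From mathcomp Require Import all_boot.

Set Implicit Arguments.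
Unset Strict Implicit.
Unset Printing Implicit Defensive.

Record sgraph := SGraph {
  vertex :> finType;
  adj : rel vertex;
  adj_sym : symmetric adj;
  adj_irr : irreflexive adj }.

Definition isomorphic (G H : sgraph) : Prop :=
  exists2 f : G -> H, bijective f & forall x y, adj (f x) (f y) = adj x y.

Record subgraph (G : sgraph) := Subgraph {
  sub_verts : {set G};
  sub_adj : rel G;
  sub_adj_sym : symmetric sub_adj;
  sub_adj_verts : forall x y, sub_adj x y -> x \in sub_verts;
  sub_adj_adj : forall x y, sub_adj x y -> adj x y }.

Section SubgraphAsGraph.
Variables (G : sgraph) (S : subgraph G).
Definition subgraph_rel : rel {x : G | x \in sub_verts S} :=
  fun x y => sub_adj S (val x) (val y).
Lemma subgraph_rel_sym : symmetric subgraph_rel.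
Proof. by move=> x y; apply: sub_adj_sym. Qed.
Lemma subgraph_rel_irr : irreflexive subgraph_rel.
Proof. by move=> x; apply/negP => /sub_adj_adj; rewrite adj_irr. Qed.
Definition graph_of_subgraph : sgraph :=
  SGraph subgraph_rel_sym subgraph_rel_irr.
End SubgraphAsGraph.

Section Complete.
Variable n : nat.
Definition complete_rel : rel 'I_n := fun i j => i != j.
Lemma complete_sym : symmetric complete_rel.
Proof. by move=> i j; rewrite /complete_rel eq_sym. Qed.
Lemma complete_irr : irreflexive complete_rel.
Proof. by move=> i; rewrite /complete_rel eqxx. Qed.
Definition complete_graph : sgraph := SGraph complete_sym complete_irr.
End Complete.

Section Path.
Variable t : nat.
Definition path_rel : rel 'I_t := fun i j => (i.+1 == j) || (j.+1 == i).
Lemma path_sym : symmetric path_rel.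
Proof. by move=> i j; rewrite /path_rel orbC. Qed.
Lemma path_irr : irreflexive path_rel.
Proof. by move=> i; rewrite /path_rel orbb gtn_eqF. Qed.
Definition path_graph : sgraph := SGraph path_sym path_irr.
End Path.

(* The star K_{1,k}; its center is [None]. *)
Section Star.
Variable k : nat.
Definition star_rel : rel (option 'I_k) := fun x y => isSome x != isSome y.
Lemma star_sym : symmetric star_rel.
Proof. by move=> x y; rewrite /star_rel eq_sym. Qed.
Lemma star_irr : irreflexive star_rel.
Proof. by move=> x; rewrite /star_rel eqxx. Qed.
Definition star_graph : sgraph := SGraph star_sym star_irr.
End Star.

(* The vertices [inr j] form the path and the [inl i] are the leaves of the
   star, whose center is the end-point of index 0 of the path (so t >= 1 is
   needed for this to be a broom). *)
Section Broom.
Variables s t : nat.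
Definition broom_rel : rel ('I_s + 'I_t)%type := fun x y =>
  match x, y with
  | inl _, inl _ => false
  | inl _, inr j => val j == 0
  | inr i, inl _ => val i == 0
  | inr i, inr j => path_rel i j
  end.
Lemma broom_sym : symmetric broom_rel.
Proof. by move=> [i|i] [j|j] //=; apply: path_sym. Qed.
Lemma broom_irr : irreflexive broom_rel.
Proof. by move=> [i|i] //=; apply: path_irr. Qed.
Definition broom : sgraph := SGraph broom_sym broom_irr.
End Broom.

Section DoubleStar.
Variables k l : nat.
Definition double_star_rel : rel (option 'I_k + option 'I_l)%type :=
  fun x y =>
  match x, y with
  | inl u, inl v => star_rel u v
  | inr u, inr v => star_rel u v
  | inl u, inr v => (u == None) && (v == None)
  | inr u, inl v => (u == None) && (v == None)
  end.
Lemma double_star_sym : symmetric double_star_rel.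
Proof.
by case=> [u|u] [v|v];
  [apply: star_sym|apply: andbC|apply: andbC|apply: star_sym].
Qed.
Lemma double_star_irr : irreflexive double_star_rel.
Proof. by case=> [u|u]; apply: star_irr. Qed.
Definition double_star : sgraph := SGraph double_star_sym double_star_irr.
End DoubleStar.

Definition edges (G : sgraph) : {set {set G}} :=
  [set [set p.1; p.2] | p : G * G & adj p.1 p.2].

Definition edge_coloring (G : sgraph) (k : nat) : Type :=
  {e : {set G} | e \in edges G} -> 'I_k.

Definition subgraph_edge (G : sgraph) (S : subgraph G) (e : {set G}) : Prop :=
  exists x y, sub_adj S x y /\ e = [set x; y].

Definition has_all_colors (G : sgraph) (k : nat) (col : edge_coloring G k)
    (S : subgraph G) : Prop :=
  forall c : 'I_k, exists2 e, subgraph_edge S (val e) & col e = c.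

Definition xi_colorable (H : sgraph) (n : nat) : Prop :=
  exists col : edge_coloring (complete_graph n) 3,
  forall S : subgraph (complete_graph n),
    isomorphic (graph_of_subgraph S) H -> has_all_colors col S.

(* xi(H) = n. The largest n is unique when it exists; as a relation this also
   asserts that it does exist. *)
Definition is_xi (H : sgraph) (n : nat) : Prop :=
  xi_colorable H n /\ forall m, xi_colorable H m -> m <= n.

(* Main.v *)
(** Call a graph unavoidable if every 3-coloring of a complete graph of its own
    order contains a copy of it that misses a color.  If [H] is unavoidable then
    [xi H < |V(H)|], while [K_(|V(H)|-1)] contains no copy of [H] at all.
    Unavoidability is propagated along growing trees, each obtained from its
    predecessor by adding a leaf: P_1, ..., P_6, then P_4, B_{2,3}, B_{3,3},
    B_{3,4}, and B_{2,3}, S_{2,2}.  In one step, delete a vertex, take a copy of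
    the smaller tree missing a color, and label the vertices along this copy;
    after renaming the colors it misses color 0.  The statement that each copy
    of the larger tree has all three colors is then an unsatisfiable set of
    clauses "some edge of this copy has color c", refuted by a short
    backtracking search. *)
Require Import Defs.
From mathcomp Require Import all_boot fingroup perm.

Set Implicit Arguments.
Unset Strict Implicit.
Unset Printing Implicit Defensive.

(** * Backtracking refutation of color clauses *)

(* The clause [(c, es)] asserts that some edge of [es] has color [c]. *)
Definition clause : Type := nat * seq (nat * nat).

Definition satisfies (v : nat * nat -> nat) (cl : clause) : bool :=
  has (fun e => v e == cl.1) cl.2.

Definition assign (e : nat * nat) (k : nat) (cls : seq clause) : seq clause :=
  [seq (cl.1, [seq d <- cl.2 | d != e])
     | cl <- cls & ~~ ((cl.1 == k) && (e \in cl.2))].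

(** Any edge would be sound; one from a shortest clause keeps the search small. *)
Definition branching_edge (cls : seq clause) : nat * nat :=
  last (0, 0) (foldr (fun cl es =>
    if nilp es || (size cl.2 < size es) then cl.2 else es) [::] cls).

(* The conditional must not be replaced by [||], which [vm_compute] evaluates
   on both sides. *)
Fixpoint refutes (fuel : nat) (cls : seq clause) : bool :=
  if fuel is fuel'.+1 then
    if has (fun cl => nilp cl.2) cls then true else
    let e := branching_edge cls in
    all (fun k => refutes fuel' (assign e k cls)) (iota 0 3)
  else false.

(** The edge satisfying a surviving clause is not [e]: otherwise the clause would have color [v e]
    and contain [e], and so would have been dropped. *)
Lemma satisfies_assign v e cls :
  all (satisfies v) cls -> all (satisfies v) (assign e (v e) cls).
Proof.
move=> /allP sat; apply/allP => _ /mapP [cl + ->].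
rewrite mem_filter => /andP [ncl /sat /hasP [d d_cl /eqP vd]].
apply/hasP; exists d; rewrite /= ?vd // mem_filter d_cl andbT.
by apply: contraNneq ncl => <-; rewrite vd eqxx d_cl.
Qed.

Lemma refutesP v fuel cls :
  (forall e, v e < 3) -> refutes fuel cls -> ~~ all (satisfies v) cls.
Proof.
move=> v_lt3; elim: fuel cls => // fuel IHfuel cls /=.
case: hasP => [[cl cl_cls /nilP cl0] _ | _ ref].
  by apply/allPn; exists cl; rewrite // /satisfies cl0.
apply: contra (@satisfies_assign v (branching_edge cls) cls) _.
apply: IHfuel; move: (v_lt3 (branching_edge cls)) ref.
by case: (v (branching_edge cls)) => [|[|[|]]] // _ /and4P [].
Qed.

(** * Unavoidable trees *)

Definition avoids_color (V : eqType) (f : V -> V -> 'I_3) (x0 : V)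
    (E : seq (nat * nat)) (s : seq V) (c : 'I_3) : bool :=
  all (fun e => f (nth x0 s e.1) (nth x0 s e.2) != c) E.

(** Vertices form a list and a copy is a rearrangement of it, tree vertex [i] being entry [i].
    Deleting a vertex then drops an entry, with no change of [V] or [f]. *)
Definition unavoidable (n : nat) (E : seq (nat * nat)) : Prop :=
  forall (V : eqType) (f : V -> V -> 'I_3) (x0 : V) (s : seq V),
  (forall x y, f x y = f y x) -> size s = n ->
  exists t c, perm_eq t s /\ avoids_color f x0 E t c.

(** Sorting the end-points gives each unordered pair a single variable. *)
Definition relabel_edge (p : seq nat) (e : nat * nat) : nat * nat :=
  let x := nth 0 p e.1 in let y := nth 0 p e.2 in
  if x < y then (x, y) else (y, x).

(* Meant for [E] in which all vertices from [k] on are interchangeable: listing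
   their images in increasing order loses no copy. *)
Definition copies (k n : nat) (E : seq (nat * nat)) : seq (seq (nat * nat)) :=
  [seq [seq relabel_edge p e | e <- E]
     | p <- permutations (iota 0 n) & sorted ltn (drop k p)].

(** The edges of [E] are known to miss color 0, so they are struck from the clauses of color 0. *)
Definition clauses (k n : nat) (E E' : seq (nat * nat)) : seq clause :=
  [seq (0, [seq e <- es | e \notin E]) | es <- copies k n E'] ++
  [seq (c, es) | c <- [:: 1; 2], es <- copies k n E'].

Definition edges_below (n : nat) (E : seq (nat * nat)) : bool :=
  all (fun e => (e.1 < n) && (e.2 < n)) E.

(** Each branching removes an edge from all clauses, so a fuel exceeding the number of vertex pairs
    suffices. *)
Definition extends (k n : nat) (E E' : seq (nat * nat)) : bool :=
  [&& edges_below n E, edges_below n.+1 E' &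
  refutes (n.+1 * n.+1) (clauses k n.+1 E E')].

Lemma unavoidable1 : unavoidable 1 [::].
Proof. by move=> V f x0 s _ _; exists s, ord0. Qed.

Lemma unsatisfied_copy v k n E E' :
  ~~ all (satisfies v) (clauses k n E E') ->
  (forall e, e \in E -> v e != 0) ->
  exists p c, [/\ perm_eq p (iota 0 n), c < 3 &
    all (fun e => v (relabel_edge p e) != c) E'].
Proof.
move=> /allPn [cl cl_in unsat] vE.
have [es es_in [c3 cl_es]] : exists2 es, es \in copies k n E' &
    cl.1 < 3 /\ {in es, forall e, v e != cl.1}.
  move: cl_in; rewrite mem_cat => /orP [/mapP|/allpairsP].
    move=> [es es_in def_cl]; exists es => //.
    move: unsat; rewrite def_cl => /hasPn unsat; split=> // e e_es.
    have [/vE //|eE] := boolP (e \in E).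
    by apply: unsat; rewrite mem_filter eE.
  move=> [[c es] /= [c_in es_in def_cl]]; exists es => //.
  move: unsat; rewrite def_cl => /hasPn unsat; split=> //.
  by move: c_in; rewrite !inE => /orP [] /eqP ->.
move: es_in => /mapP [p]; rewrite mem_filter mem_permutations => /andP [_ pP].
move=> def_es; exists p, cl.1; split=> //.
by apply/allP => e eE'; apply: cl_es; rewrite def_es map_f.
Qed.

Lemma unavoidable_extends k n E E' :
  unavoidable n E -> extends k n E E' -> unavoidable n.+1 E'.
Proof.
move=> unavE /and3P [/allP E_lt /allP E'_lt ref] V f x0 [|x s] // fC [size_s].
have [t [c [t_s /allP t_c]]] := unavE V f x0 s fC size_s.
have size_t : size t = n by rewrite (perm_size t_s).
(* The deleted vertex [x] gets label [n], after the labels of the copy [t]. *)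
pose u := rcons t x.
pose v e : nat := tperm c ord0 (f (nth x0 u e.1) (nth x0 u e.2)).
have vE e : e \in E -> v e != 0.
  move=> eE; have /andP [e1 e2] := E_lt _ eE.
  rewrite /v !nth_rcons size_t e1 e2 -[0]/(val (@ord0 2)) (inj_eq val_inj).
  by rewrite (can2_eq (tpermK _ _) (tpermK _ _)) tpermR t_c.
have [p [c' [p_iota c'3 p_c']]] :=
  unsatisfied_copy (refutesP (v := v) (fun e => ltn_ord _) ref) vE.
have size_p : size p = n.+1 by rewrite (perm_size p_iota) size_iota.
(* [u] turns the labels in [p] back into vertices; the transposition, its own inverse, restores the
   color. *)
exists [seq nth x0 u i | i <- p], (tperm c ord0 (Ordinal c'3)); split.
  have u_xs : perm_eq u (x :: s) by rewrite perm_rcons perm_cons.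
  apply: perm_trans (perm_map (nth x0 u) p_iota) _.
  by rewrite -size_t -(size_rcons t x) -/(mkseq _ _) mkseq_nth.
apply/allP => e eE'; have /andP [e1 e2] := E'_lt _ eE'.
rewrite !(nth_map 0) ?size_p //.
apply: contra (allP p_c' _ eE') => /eqP f_e.
have -> : v (relabel_edge p e) = v (nth 0 p e.1, nth 0 p e.2).
  by rewrite /relabel_edge; case: ifP => //= _; rewrite /v /= fC.
by rewrite /v /= f_e tpermK.
Qed.

(** * From unavoidable edge lists to xi *)

Section UpperBound.
Variables (H : sgraph) (m n : nat) (E : seq (nat * nat)) (r : H -> nat).
Hypothesis r_inj : injective r.
Hypothesis r_lt : forall x, r x < n.
Hypothesis r_edge :
  forall x y, adj x y -> ((r x, r y) \in E) || ((r y, r x) \in E).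

(** The default [ord0] occurs only for [i = j], where [[set i; j]] is no edge. *)
Definition pair_color (col : edge_coloring (complete_graph m) 3)
    (i j : 'I_m) : 'I_3 :=
  if insub [set i; j] is Some e then col e else ord0.

Lemma pair_colorC col : commutative (pair_color col).
Proof. by move=> i j; rewrite /pair_color setUC. Qed.

Section Copy.
Variable g : H -> complete_graph m.
Hypothesis g_inj : injective g.

Definition copy_adj : rel (complete_graph m) :=
  fun u v => [exists x, exists y, [&& adj x y, g x == u & g y == v]].

Lemma copy_adjP u v :
  reflect (exists x y, [/\ adj x y, g x = u & g y = v]) (copy_adj u v).
Proof.
apply: (iffP existsP) => [[x /existsP [y /and3P [xy /eqP gx /eqP gy]]]|].
  by exists x, y.
by move=> [x [y [xy gx gy]]]; exists x; apply/existsP; exists y;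
  rewrite xy gx gy !eqxx.
Qed.

Lemma copy_adj_sym : symmetric copy_adj.
Proof.
by move=> u v; apply/copy_adjP/copy_adjP => -[x [y [xy gx gy]]];
  exists y, x; rewrite adj_sym.
Qed.

Lemma copy_adj_verts u v : copy_adj u v -> u \in [set g x | x in H].
Proof. by case/copy_adjP => x [y [_ <- _]]; rewrite imset_f. Qed.

Lemma copy_adj_adj u v : copy_adj u v -> adj u v.
Proof.
case/copy_adjP => x [y [xy <- <-]]; apply: contraTneq xy => /g_inj ->.
by rewrite adj_irr.
Qed.

Definition copy : subgraph (complete_graph m) :=
  Subgraph copy_adj_sym copy_adj_verts copy_adj_adj.

(** The isomorphism leaves the copy, so it is built by choosing preimages under [g]. *)
Lemma copy_isomorphic : isomorphic (graph_of_subgraph copy) H.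
Proof.
have pre (u : graph_of_subgraph copy) : exists x, g x == val u.
  by have /imsetP [x _ ->] := valP u; exists x.
pose h u := xchoose (pre u).
have hK u : g (h u) = val u by apply/eqP/(xchooseP (pre u)).
have h_adj u v : adj (h u) (h v) = adj u v.
  apply/idP/copy_adjP => [uv|[x [y [xy gx gy]]]].
    by exists (h u), (h v); rewrite !hK.
  rewrite -(g_inj (etrans gx (esym (hK u)))).
  by rewrite -(g_inj (etrans gy (esym (hK v)))).
exists h => //.
pose k x : graph_of_subgraph copy := Sub (g x) (imset_f g (isT : x \in H)).
exists k => [u|x]; first by apply: val_inj; rewrite /= hK.
by apply: g_inj; rewrite hK.
Qed.

End Copy.

(** If [n <= m], some [n] vertices carry a copy of [H] missing a color [c], yet the coloring puts an
    edge of color [c] in it. *)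
Lemma unavoidable_bound :
  0 < n -> unavoidable n E -> xi_colorable H m -> m < n.
Proof.
move=> n_gt0 unavE [col all_colors]; rewrite ltnNge; apply/negP => le_nm.
have [s [size_s s_uniq]] : exists s : seq 'I_m, size s = n /\ uniq s.
  exists (take n (enum 'I_m)); rewrite take_uniq ?enum_uniq //.
  by rewrite size_takel // size_enum_ord.
pose v0 : 'I_m := Ordinal (leq_trans n_gt0 le_nm).
have [t [c [t_s /allP t_c]]] :=
  unavE _ (pair_color col) v0 s (pair_colorC col) size_s.
have size_t : size t = n by rewrite (perm_size t_s).
have t_uniq : uniq t by rewrite (perm_uniq t_s).
pose g x : complete_graph m := nth v0 t (r x).
have g_inj : injective g.
  by move=> x y /eqP; rewrite nth_uniq ?size_t ?r_lt // => /eqP /r_inj.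
have [e [_ [_ [/copy_adjP [x [y [xy <- <-]]] def_e]]] col_e] :=
  all_colors _ (copy_isomorphic g_inj) c.
have gxy : pair_color col (g x) (g y) = c.
  by rewrite /pair_color -def_e valK.
by case/orP: (r_edge xy) => /t_c;
  rewrite /= -!/(g _) ?(pair_colorC col (g y)) gxy eqxx.
Qed.

End UpperBound.

(** Vacuous: a copy of [H] would need more than [n] vertices. *)
Lemma xi_colorable_small (H : sgraph) (n : nat) : n < #|H| -> xi_colorable H n.
Proof.
move=> lt_n; exists (fun=> ord0) => S [f f_bij _].
suff: #|H| <= n by rewrite leqNgt lt_n.
rewrite -(bij_eq_card f_bij) card_sig -[X in _ <= X]card_ord.
exact: max_card.
Qed.

Lemma is_xi_unavoidable (H H0 : sgraph) (n : nat) (E : seq (nat * nat))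
    (r : H0 -> nat) :
    isomorphic H H0 -> #|H0| = n.+1 -> injective r ->
    (forall x, r x < n.+1) ->
    (forall x y, adj x y -> ((r x, r y) \in E) || ((r y, r x) \in E)) ->
  unavoidable n.+1 E -> is_xi H (#|H| - 1).
Proof.
move=> [f f_bij f_adj] cardH0 r_inj r_lt r_edge unavE.
rewrite (bij_eq_card f_bij) cardH0 subSS subn0; split=> [|m colm].
  by apply: xi_colorable_small; rewrite (bij_eq_card f_bij) cardH0.
rewrite -ltnS; apply: (unavoidable_bound (r := r \o f)) unavE colm => //.
- exact: inj_comp r_inj (bij_inj f_bij).
- by move=> x; apply: r_lt.
- by move=> x y xy; apply: r_edge; rewrite f_adj.
Qed.

(** * The six trees *)

Definition path_edges (t : nat) : seq (nat * nat) :=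
  [seq (i, i.+1) | i <- iota 0 t.-1].

(** The star leaves get the last labels, so [copies] with [k = t] treats exactly them as
    interchangeable. *)
Definition broom_edges (s t : nat) : seq (nat * nat) :=
  path_edges t ++ [seq (0, t + i) | i <- iota 0 s].

Definition double_star_edges (k l : nat) : seq (nat * nat) :=
  (0, 1) :: [seq (0, 2 + i) | i <- iota 0 k] ++
            [seq (1, 2 + k + i) | i <- iota 0 l].

Definition broom_label (s t : nat) (x : broom s t) : nat :=
  match x with inl i => t + i | inr j => j end.

Definition double_star_label (k l : nat) (x : double_star k l) : nat :=
  match x with
  | inl None => 0
  | inr None => 1
  | inl (Some i) => 2 + i
  | inr (Some j) => 2 + k + j
  end.

Lemma is_xi_path (H : sgraph) (t : nat) :
  isomorphic H (path_graph t.+1) -> unavoidable t.+1 (path_edges t.+1) ->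
  is_xi H (#|H| - 1).
Proof.
move=> iso; apply: (@is_xi_unavoidable _ (path_graph t.+1) _ _ val iso).
- exact: card_ord.
- exact: val_inj.
- by move=> i; apply: ltn_ord.
have in_path i j : i.+1 = j -> j < t.+1 -> (i, j) \in path_edges t.+1.
  by move=> <- lt_i; apply/mapP; exists i; rewrite // mem_iota.
by move=> i j /orP [] /eqP ij; [|rewrite orbC]; rewrite in_path ?ltn_ord.
Qed.

Lemma is_xi_broom (H : sgraph) (s t : nat) :
    isomorphic H (broom s t.+1) ->
    unavoidable (s + t).+1 (broom_edges s t.+1) ->
  is_xi H (#|H| - 1).
Proof.
move=> iso; apply: (is_xi_unavoidable (r := @broom_label s t.+1) iso).
- by rewrite card_sum !card_ord addnS.
- move=> [i|i] [j|j] /=.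
  + by move/addnI/val_inj->.
  + by move=> ij; have := ltn_ord j; rewrite -ij ltnNge leq_addr.
  + by move=> ij; have := ltn_ord i; rewrite ij ltnNge leq_addr.
  + by move/val_inj->.
- move=> [i|j] /=; first by rewrite addSn ltnS addnC ltn_add2r.
  by rewrite (leq_trans (ltn_ord j)) // ltnS leq_addl.
have in_path i j : i.+1 = j -> j < t.+1 -> (i, j) \in broom_edges s t.+1.
  move=> <- lt_i; rewrite mem_cat; apply/orP; left.
  by apply/mapP; exists i; rewrite // mem_iota.
have in_star (i : 'I_s) : (0, t.+1 + i) \in broom_edges s t.+1.
  by rewrite mem_cat orbC map_f // mem_iota ltn_ord.
move=> [i|i] [j|j] //= => [/eqP-> | /eqP-> | ].
- by rewrite in_star orbT.
- by rewrite in_star.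
by case/orP=> /eqP ij; [|rewrite orbC]; rewrite in_path ?ltn_ord.
Qed.

Lemma is_xi_double_star (H : sgraph) (k l : nat) :
    isomorphic H (double_star k l) ->
    unavoidable (k + l).+2 (double_star_edges k l) ->
  is_xi H (#|H| - 1).
Proof.
move=> iso; apply: (is_xi_unavoidable (r := @double_star_label k l) iso).
- by rewrite card_sum !card_option !card_ord addSn addnS.
- move=> [[i|]|[i|]] [[j|]|[j|]] //= => [[] | [] ij | [] ij | []].
  + by move/val_inj->.
  + by have := ltn_ord i; rewrite (ij : i = k + j :> nat) ltnNge leq_addr.
  + by have := ltn_ord j; rewrite -(ij : k + i = j) ltnNge leq_addr.
  + by move/addnI/val_inj->.
- move=> [[i|]|[i|]] //=; last by rewrite !ltnS ltn_add2l.
  by rewrite !ltnS (leq_trans (ltn_ord i)) ?leq_addr.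
have in_l (i : 'I_k) : (0, 2 + i) \in double_star_edges k l.
  by rewrite inE mem_cat map_f ?orbT // mem_iota ltn_ord.
have in_r (i : 'I_l) : (1, 2 + k + i) \in double_star_edges k l.
  rewrite inE mem_cat (map_f (fun j => (1, 2 + k + j))) ?orbT //.
  by rewrite mem_iota ltn_ord.
by move=> [[i|]|[i|]] [[j|]|[j|]] //= _; rewrite ?in_l ?in_r ?orbT.
Qed.

Lemma unavoidable_path4 : unavoidable 4 (path_edges 4).
Proof.
have P2 : unavoidable 2 (path_edges 2).
  (* For paths [k] is the full order, so [copies] uses every permutation. *)
  by apply: (unavoidable_extends (k := 2) unavoidable1); vm_compute.
have P3 : unavoidable 3 (path_edges 3).
  by apply: (unavoidable_extends (k := 3) P2); vm_compute.
by apply: (unavoidable_extends (k := 4) P3); vm_compute.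
Qed.

Lemma unavoidable_path5 : unavoidable 5 (path_edges 5).
Proof.
by apply: (unavoidable_extends (k := 5) unavoidable_path4); vm_compute.
Qed.

Lemma unavoidable_path6 : unavoidable 6 (path_edges 6).
Proof.
by apply: (unavoidable_extends (k := 6) unavoidable_path5); vm_compute.
Qed.

Lemma unavoidable_broom23 : unavoidable 5 (broom_edges 2 3).
Proof.
by apply: (unavoidable_extends (k := 3) unavoidable_path4); vm_compute.
Qed.

Lemma unavoidable_broom33 : unavoidable 6 (broom_edges 3 3).
Proof.
by apply: (unavoidable_extends (k := 3) unavoidable_broom23); vm_compute.
Qed.

Lemma unavoidable_broom34 : unavoidable 7 (broom_edges 3 4).
Proof.
by apply: (unavoidable_extends (k := 4) unavoidable_broom33); vm_compute.
Qed.

(* The leaves of different stars are not interchangeable, so listing all four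
   in increasing order does lose copies; those that remain suffice. *)
Lemma unavoidable_double_star22 : unavoidable 6 (double_star_edges 2 2).
Proof.
by apply: (unavoidable_extends (k := 4) unavoidable_broom23); vm_compute.
Qed.

Theorem lemma1p5 (H : sgraph)
  (hH : isomorphic H (path_graph 4) \/ isomorphic H (path_graph 5) \/
        isomorphic H (path_graph 6) \/ isomorphic H (broom 3 3) \/
        isomorphic H (broom 3 4) \/ isomorphic H (double_star 2 2)) :
  is_xi H (#|H| - 1).
Proof.
move: hH => [iso|[iso|[iso|[iso|[iso|iso]]]]].
- exact: is_xi_path iso unavoidable_path4.
- exact: is_xi_path iso unavoidable_path5.
- exact: is_xi_path iso unavoidable_path6.
- exact: is_xi_broom iso unavoidable_broom33.
- exact: is_xi_broom iso unavoidable_broom34.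
- exact: is_xi_double_star iso unavoidable_double_star22.
Qed.
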